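(* Let $a,b\ge 0$ and let $\alpha,\beta$ be given real numbers, and define the function $$f_{\alpha,\beta}(x)=(x+a)^{\alpha}\left[\psi(x+b)-\psi(x+a)-\frac{\beta}{x+a}\right]$$ for $x>\max(-a,-b)$. (i) If $b=a$, then $f_{\alpha,\beta}(x)$ is completely monotone on $(-a,\infty)$ if and only if one of the following conditions holds: ($i_1$) $\beta=0$, $\alpha$ is arbitrary; ($i_2$) $\beta<0$, $\alpha\le 1$. (ii) If $b=a+1$, then $f_{\alpha,\beta}(x)$ is completely monotone on $(-a,\infty)$ if and only if one of the following conditions holds: ($ii_1$) $\beta=1$, $\alpha$ is arbitrary; ($ii_2$) $\beta<1$, $\alpha\le 1$. (iii) Let $b\ne a,a+1$. Assume that $0<1-b+a<1$ and $\beta\le b-a$. ($iii_1$) Let $\alpha\le 1$. Then the function $f_{\alpha,\beta}(x)$ is completely monotone on $(-a,\infty)$. The lower and upper bounds for $b$, $a<b$ and $b<a+1$, are sharp, and the upper bound for $\beta$ is sharp. ($iii_2$) Let the function $f_{\alpha,\beta}(x)$ be completely monotone on $(-a,\infty)$. If $\beta<b-a$ then $\alpha\le 1$; if $\beta=b-a$ then $\alpha\le 2$.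
   Context: A function $f:I\to\mathbb{R}$, where $I\subseteq\mathbb{R}$ is an interval, is called completely monotone if it has derivatives of all orders and $(-1)^n f^{(n)}(x)\ge 0$ for all $n=0,1,2,\ldots$ and all $x\in I$. Here $\Gamma$ is the Gamma function and $\psi(z)=\Gamma'(z)/\Gamma(z)$ ($z\ne 0,-1,-2,\ldots$) is the digamma function. *)

(* Defs.v *)
From mathcomp Require Import all_boot all_order all_algebra.
From mathcomp Require Import all_classical all_reals all_analysis.

Set Implicit Arguments.
Unset Strict Implicit.
Unset Printing Implicit Defensive.

Import Order.TTheory GRing.Theory Num.Theory.
Import numFieldNormedType.Exports.

Local Open Scope ring_scope.

(* Euler's integral: this is the Gamma function for 0 < x only.  For x <= 0
   the integral diverges and the value is the junk [fine +oo = 0]. *)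
Definition Gamma (R : realType) (x : R) : R :=
  \int[lebesgue_measure]_(t in `]0, +oo[) (t `^ (x - 1) * expR (- t)).

(* Meaningful for 0 < x, like [Gamma]. *)
Definition digamma (R : realType) (x : R) : R := derive1 (@Gamma R) x / Gamma x.

(* [derivable _ x 1] is two-sided differentiability at x, so I has to be an
   open interval; the values of f outside I are then irrelevant. *)
Definition completely_monotone (R : realType) (I : interval R) (f : R -> R) :
    Prop :=
  forall (n : nat) (x : R), x \in I ->
    derivable (derive1n n f) x 1 /\ 0 <= (-1) ^+ n * derive1n n f x.

(* Meaningful for Num.max (- a) (- b) < x. *)
Definition f_ab (R : realType) (a b alpha beta : R) (x : R) : R :=
  (x + a) `^ alpha * (digamma (x + b) - digamma (x + a) - beta / (x + a)).

(* Main.v *)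
(* With t = x + a and d = b - a, f(x) = t^(alpha-1) (t g(t) - beta) where
   g(t) = digamma (t + d) - digamma t.  Integrating Jensen's inequality
   t^(y-x) >= e^c (1 + (y - x) ln t - c) against Euler's integrand shows that
   digamma is nondecreasing, so 0 <= g(t) <= 1/t for 0 <= d <= 1, and then
   digamma (t + 1) = digamma t + 1/t determines g by telescoping.  Summing by
   parts yields, for 0 < d < 1,
     t g(t) = d + \sum_m (m+1) d (1-d) / ((t+m+d) (t+m+1) (t+m+1+d)),
   a series of completely monotone rational functions, whence f is completely
   monotone for alpha <= 1 and beta <= d.  The necessary conditions follow from
   the sign of f near the endpoints of the interval and, since f is
   nonincreasing, from its growth: t g(t) - d behaves like d (1-d) / (2 t). *)

Require Import Defs.
From mathcomp Require Import all_boot all_order all_algebra.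
From mathcomp Require Import all_classical all_reals all_analysis.
From mathcomp Require Import measurable_realfun ring lra.

Set Implicit Arguments.
Unset Strict Implicit.
Unset Printing Implicit Defensive.

Import Order.TTheory GRing.Theory Num.Theory.
Import numFieldNormedType.Exports.

Local Open Scope classical_set_scope.
Local Open Scope ring_scope.

Lemma is_derive1_shift (R : realType) (f : R -> R) (c x l : R) :
  is_derive (x + c) 1 f l -> is_derive x 1 (fun z => f (z + c)) l.
Proof.
move=> df; rewrite -[l]mulr1; apply: (@is_derive1_comp R f (+%R^~ c)).
by apply: is_derive_eq; rewrite addr0.
Qed.

(** * The Gamma and digamma functions on the positive half-line *)

Section gamma_integrand.
Context {R : realType}.
Implicit Types s t : R.

Definition gamma_integrand s t := t `^ (s - 1) * expR (- t).

Lemma gamma_integrand_ge0 s t : 0 <= gamma_integrand s t.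
Proof. by rewrite mulr_ge0 ?powR_ge0 ?expR_ge0. Qed.

Lemma gamma_integrandE s t : 0 < t ->
  gamma_integrand s t = expR ((s - 1) * ln t - t).
Proof. by move=> t0; rewrite /gamma_integrand /powR gt_eqF// -expRD. Qed.

Lemma is_derive_gamma_integrand s t : 0 < t ->
  is_derive t 1 (gamma_integrand (s + 1))
    (s * gamma_integrand s t - gamma_integrand (s + 1) t).
Proof.
move=> t0; have ? := @is_derive1_powR R (s + 1 - 1) t t0.
apply: is_derive_eq; rewrite /gamma_integrand /GRing.scale/= !addrK.
by ring.
Qed.

Lemma continuous_gamma_integrand s t : 0 < t ->
  {for t, continuous (gamma_integrand s)}.
Proof.
move=> t0; have := @is_derive_gamma_integrand (s - 1) t t0; rewrite subrK => d.
by apply: differentiable_continuous; apply/derivable1_diffP.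
Qed.

Lemma measurable_gamma_integrand s D : measurable D ->
  measurable_fun D (gamma_integrand s).
Proof.
move=> mD; apply: measurable_funTS; apply: measurable_funM.
  exact: measurable_powR.
by apply: measurableT_comp => //; exact: measurableT_comp.
Qed.

(** Half of the exponential decay absorbs the power: apply ln u < u at u = t / (2 s). *)
Lemma gamma_integrand_le s t : 0 < s -> 0 < t ->
  gamma_integrand (s + 1) t <= expR (s * ln (2 * s)) * expR (- (t / 2)).
Proof.
move=> s0 t0; rewrite gamma_integrandE// -expRD ler_expR addrK.
have s20 : 0 < 2 * s by lra.
suff : s * ln (t / (2 * s)) <= t / 2.
  by rewrite ln_div ?posrE//; lra.
have -> : t / 2 = s * (t / (2 * s)) by field; rewrite gt_eqF.
by rewrite ler_pM2l// ltW// ln_sublinear// divr_gt0.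
Qed.

Lemma gamma_integrand_cvg_pinfty s : 0 < s ->
  gamma_integrand (s + 1) (k.+1%:R) @[k --> \oo] --> (0 : R).
Proof.
move=> s0.
have c0 : expR (s * ln (2 * s)) * 2 * @harmonic R k @[k --> \oo] --> (0 : R).
  rewrite -[X in _ --> X](mulr0 (expR (s * ln (2 * s)) * 2)).
  by apply: cvgMl_tmp; exact: cvg_harmonic.
apply: (@squeeze_cvgr _ _ _ _ (cst 0) _ _ _ _ _ c0); last exact: cvg_cst.
apply/nearW => k; rewrite gamma_integrand_ge0/=.
apply: le_trans (gamma_integrand_le s0 _) _; first by rewrite ltr0n.
rewrite -mulrA ler_pM2l ?expR_gt0// expRN /harmonic/=.
have k0 : 0 < k.+1%:R :> R by rewrite ltr0n.
have -> : 2 * k.+1%:R^-1 = (k.+1%:R / 2)^-1 :> R by field; rewrite gt_eqF.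
rewrite lef_pV2 ?posrE ?expR_gt0//.
by apply: le_trans (expR_ge1Dx _); lra.
Qed.

Lemma gamma_integrand_cvg_0 s : 0 < s ->
  gamma_integrand (s + 1) k.+1%:R^-1 @[k --> \oo] --> (0 : R).
Proof.
move=> s0.
have c0 : (@harmonic R k) `^ s @[k --> \oo] --> (0 : R).
  have /cvg_at_rightP := powR_cvg0 s0; apply; split.
    by move=> n; exact: harmonic_gt0.
  exact: cvg_harmonic.
apply: (@squeeze_cvgr _ _ _ _ (cst 0) _ _ _ _ _ c0); last exact: cvg_cst.
apply/nearW => k; rewrite gamma_integrand_ge0/= /gamma_integrand addrK.
by rewrite ler_piMr ?powR_ge0// -expR0 ler_expR oppr_le0 invr_ge0.
Qed.

End gamma_integrand.

(** * Integration by parts and convergence of Euler's integral *)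

Section gamma_integral.
Context {R : realType}.
Implicit Types s t : R.
Local Notation mu := (@lebesgue_measure R).
Local Notation gamma_integrand := (@gamma_integrand R).

Lemma integrable_gamma_integrand_compact s a b : 0 < a ->
  mu.-integrable `[a, b] (EFin \o gamma_integrand s).
Proof.
move=> a0; apply: continuous_compact_integrable; first exact: segment_compact.
apply: continuous_in_subspaceT => x; rewrite inE/= in_itv/= => /andP[ax _].
exact/continuous_gamma_integrand/(lt_le_trans a0).
Qed.

(** Integration by parts, obtained from the fundamental theorem of calculus for t^s e^-t on a
    segment away from 0. *)
Lemma integral_gamma_integrand_segment s a b : 0 < a -> a < b ->
  (s%:E * \int[mu]_(t in `[a, b]) (gamma_integrand s t)%:E =
   \int[mu]_(t in `[a, b]) (gamma_integrand (s + 1) t)%:E +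
   (gamma_integrand (s + 1) b - gamma_integrand (s + 1) a)%:E)%E.
Proof.
move=> a0 ab.
have iS r := @integrable_gamma_integrand_compact r a b a0.
have x0 x : a <= x -> 0 < x by exact: lt_le_trans.
have FTC : (\int[mu]_(t in `[a, b])
    (s * gamma_integrand s t - gamma_integrand (s + 1) t)%:E =
    (gamma_integrand (s + 1) b)%:E - (gamma_integrand (s + 1) a)%:E)%E.
  apply: continuous_FTC2 => //.
  - apply: continuous_in_subspaceT => x; rewrite inE/= in_itv/= => /andP[ax _].
    have cg r := @continuous_gamma_integrand _ r x (x0 _ ax).
    by apply: cvgB; [apply: cvgMl_tmp|]; exact: cg.
  - split.
    + move=> x; rewrite in_itv/= => /andP[/ltW/x0 {}x0 _].
      by case: (is_derive_gamma_integrand s x0).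
    + exact/cvg_at_right_filter/continuous_gamma_integrand.
    + apply/cvg_at_left_filter/continuous_gamma_integrand.
      exact: lt_trans ab.
  - move=> x; rewrite in_itv/= => /andP[/ltW/x0 {}x0 _].
    by rewrite derive1E; case: (is_derive_gamma_integrand s x0).
have isZ : mu.-integrable `[a, b] (EFin \o (fun t => s * gamma_integrand s t)).
  exact: (@integrableZl _ _ _ mu _ _ s _ (iS s)).
rewrite EFinB -FTC integralB_EFin// -integralZl//; last exact: iS.
under [X in (X - _)%E]eq_integral do rewrite EFinM.
by rewrite addeC subeK// integrable_fin_num//; exact: iS.
Qed.

(** Starting at 2 makes every segment nondegenerate, 1/(k + 2) < 1 < k + 2, as the integration by
    parts requires. *)
Lemma itv0y_bigcup :
  `]0, +oo[%classic = \bigcup_k `[k.+2%:R^-1, k.+2%:R]%classic :> set R.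
Proof.
apply/seteqP; split => [x|x [k _]] /=; rewrite in_itv/= ?andbT; last first.
  by rewrite in_itv/= andbT => /andP[+ _]; apply: lt_le_trans; rewrite invr_gt0.
move=> x0; near \oo => k; exists k => //=; rewrite in_itv/=; apply/andP; split.
  rewrite -[leRHS]invrK lef_pV2 ?posrE ?ltr0n ?invr_gt0//.
  apply: (@le_trans _ _ k%:R); last by rewrite ler_nat -addn2 leq_addr.
  by near: k; exact: nbhs_infty_ger.
apply: (@le_trans _ _ k%:R); last by rewrite ler_nat -addn2 leq_addr.
by near: k; exact: nbhs_infty_ger.
Unshelve. all: end_near. Qed.

Lemma integral_gamma_integrand_cvg s :
  (\int[mu]_(t in `[k.+2%:R^-1%R, k.+2%:R]) (gamma_integrand s t)%:E @[k --> \oo]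
   --> \int[mu]_(t in `]0%R, +oo[) (gamma_integrand s t)%:E)%E.
Proof.
rewrite itv0y_bigcup; apply: ge0_nondecreasing_set_cvg_integral => //.
- apply/nondecreasing_seqP => k; rewrite subsetEset.
  apply: subset_itv; rewrite bnd_simp ?ler_nat//.
  by rewrite lef_pV2 ?posrE ?ltr0n// ler_nat.
- by move=> k; apply/measurable_EFinP; exact: measurable_gamma_integrand.
- by move=> k x _; rewrite lee_fin gamma_integrand_ge0.
Qed.

(** Limit of the identity on segments: the boundary terms vanish at 0 and at infinity. Extended real
    values allow this to come before finiteness, which is then deduced from it. *)
Lemma integral_gamma_integrandS s : 0 < s ->
  (s%:E * \int[mu]_(t in `]0%R, +oo[) (gamma_integrand s t)%:E =
   \int[mu]_(t in `]0%R, +oo[) (gamma_integrand (s + 1) t)%:E)%E.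
Proof.
move=> s0.
have h1 := cvgeZl (erefl : s%:E \is a fin_num) (@integral_gamma_integrand_cvg s).
suff h2 : (\int[mu]_(t in `[k.+2%:R^-1%R, k.+2%:R]) (gamma_integrand (s + 1) t)%:E
   + (gamma_integrand (s + 1) k.+2%:R
      - gamma_integrand (s + 1) k.+2%:R^-1)%:E @[k --> \oo] -->
   \int[mu]_(t in `]0%R, +oo[) (gamma_integrand (s + 1) t)%:E)%E.
  apply: (cvg_unique _ h1) => //; apply: cvg_trans h2; apply: near_eq_cvg.
  apply/nearW => k; apply/esym/integral_gamma_integrand_segment => //.
  by rewrite (@lt_trans _ _ 1) ?ltr1n// invf_lt1 ?ltr1n.
rewrite -[X in _ --> X]adde0; apply: cvgeD; first by rewrite fin_num_adde_defl.
  exact: integral_gamma_integrand_cvg.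
apply: cvg_EFin; first exact: nearW.
rewrite -[X in _ --> X](subrr (0 : R)); apply: cvgB.
  have := gamma_integrand_cvg_pinfty s0.
  by rewrite -(cvg_shiftS (fun k => gamma_integrand (s + 1) k.+1%:R)).
have := gamma_integrand_cvg_0 s0.
by rewrite -(cvg_shiftS (fun k => gamma_integrand (s + 1) k.+1%:R^-1)).
Qed.

(** The singularity at 0 is removed by the functional equation: s times the integral equals the one
    for s + 1, whose integrand is dominated by an exponential density of rate 1/2. *)
Lemma integrable_gamma_integrand s : 0 < s ->
  mu.-integrable `]0, +oo[ (EFin \o gamma_integrand s).
Proof.
move=> s0; apply/integrableP; split.
  by apply/measurable_EFinP; exact: measurable_gamma_integrand.
under eq_integral do rewrite /= ger0_norm ?gamma_integrand_ge0//.
suff foo : (s%:E * \int[mu]_(t in `]0%R, +oo[) (gamma_integrand s t)%:E < +oo)%E.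
  rewrite ltey; apply/eqP => oo; move: foo.
  by rewrite oo gt0_muley ?lte_fin.
rewrite integral_gamma_integrandS//.
have h2 : 0 < 2^-1 :> R by rewrite invr_gt0.
have iexp := integrable_exponential_pdf h2.
set c := expR (s * ln (2 * s)).
apply: (@le_lt_trans _ _
  (\int[mu]_(t in `]0%R, +oo[) (2 * c * exponential_pdf 2^-1 t)%:E)%E).
  apply: ge0_le_integral => //.
  - by move=> t _; rewrite lee_fin gamma_integrand_ge0.
  - by apply/measurable_EFinP; exact: measurable_gamma_integrand.
  - apply/measurable_EFinP/measurable_funTS/measurable_funM => //.
    exact: measurable_exponential_pdf.
  - move=> t /=; rewrite in_itv/= andbT => t0; rewrite lee_fin.
    apply: le_trans (gamma_integrand_le s0 t0) _.
    rewrite (exponential_pdfE _ (ltW t0)) -/c.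
    rewrite (_ : - (t / 2) = - 2^-1 * t); last by field.
    rewrite [leRHS](_ : _ = c * expR (- 2^-1 * t))//; by field.
have := @integrableZl _ _ _ mu _ measurableT (2 * c) _ iexp.
move=> i2; suff /integrable_lty : mu.-integrable `]0, +oo[
    (fun t => (2 * c)%:E * (exponential_pdf 2^-1 t)%:E)%E by exact.
by apply: integrableS i2.
Qed.

End gamma_integral.

(** * Positivity, derivative and tangent inequality of Gamma *)

Section gamma_function.
Context {R : realType}.
Implicit Types s t x y : R.
Local Notation mu := (@lebesgue_measure R).
Local Notation gamma_integrand := (@gamma_integrand R).

Lemma GammaD1 s : 0 < s -> Gamma (s + 1) = s * Gamma s.
Proof.
move=> s0; rewrite /Gamma /Rintegral -integral_gamma_integrandS//.
by rewrite fineM//; apply: integrable_fin_num => //; exact: integrable_gamma_integrand.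
Qed.

(** On [1, 2], an interval of length 1, both ln t and t are at most 2, so the integrand is at least
    [c]. *)
Lemma Gamma_gt0 s : 0 < s -> 0 < Gamma s.
Proof.
move=> s0; set c := expR (- (2 * `|s - 1|) - 2).
have ig := integrable_gamma_integrand s0.
suff : (c%:E <= \int[mu]_(t in `]0%R, +oo[) (gamma_integrand s t)%:E)%E.
  rewrite -[X in (_ <= X)%E -> _]fineK; last exact: integrable_fin_num.
  by rewrite lee_fin; apply: lt_le_trans; exact: expR_gt0.
apply: (@le_trans _ _ (\int[mu]_(t in `[1%R, 2%R]) (gamma_integrand s t)%:E)%E).
  have -> : c%:E = (\int[mu]_(t in `[1%R, 2%R]) c%:E)%E.
    rewrite integral_cst//= lebesgue_measure_itv/= lte_fin ltr1n -EFinB.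
    by rewrite -EFinM; congr EFin; ring.
  apply: ge0_le_integral => //.
  - by move=> t _; rewrite lee_fin expR_ge0.
  - by apply/measurable_EFinP; exact: measurable_gamma_integrand.
  - move=> t /=; rewrite in_itv/= => /andP[t1 t2].
    have t0 : 0 < t by lra.
    rewrite lee_fin gamma_integrandE// ler_expR lerB//.
    apply: lerNnormlW; rewrite normrM mulrC ler_wpM2r//.
    by rewrite ger0_norm ?ln_ge0// (le_trans (ltW (ln_sublinear t0))).
apply: ge0_subset_integral => //.
- by apply/measurable_EFinP; exact: measurable_gamma_integrand.
- by move=> t _; rewrite lee_fin gamma_integrand_ge0.
- by move=> t /=; rewrite !in_itv/= andbT => /andP[t1 _]; lra.
Qed.

Lemma is_derive_gamma_integrand_param x t : 0 < t ->
  is_derive x 1 (gamma_integrand ^~ t) (ln t * gamma_integrand x t).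
Proof.
move=> t0; rewrite (_ : gamma_integrand ^~ t = fun x => expR ((x - 1) * ln t - t)).
  by apply: is_derive_eq; rewrite /GRing.scale/= gamma_integrandE//; ring.
by apply/funext => z; rewrite gamma_integrandE.
Qed.

(* |ln t| <= (t^e + t^-e) / e, and t^x <= t^u + t^v for u <= x <= v. *)
Lemma norm_ln_gamma_integrand_le u v e x t : 0 < e -> u <= x -> x <= v -> 0 < t ->
  `|ln t * gamma_integrand x t| <=
    e^-1 * (gamma_integrand (u + e) t + gamma_integrand (u - e) t
            + (gamma_integrand (v + e) t + gamma_integrand (v - e) t)).
Proof.
move=> e0 ux xv t0; rewrite normrM (ger0_norm (gamma_integrand_ge0 _ _)).
have gD r h : gamma_integrand (r + h) t = gamma_integrand r t * expR (h * ln t).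
  by rewrite !gamma_integrandE// -expRD; congr expR; ring.
rewrite !gD -!mulrDr -mulrDl (mulrCA e^-1) (mulrC `|ln t|); apply: ler_pM => //.
- exact: gamma_integrand_ge0.
- rewrite !gamma_integrandE// -subr_ge0.
  have [L0|L0] := leP 0 (ln t).
    rewrite subr_ge0 ler_wpDl ?expR_ge0// ler_expR lerD2r.
    by rewrite ler_wpM2r// lerB.
  rewrite subr_ge0 ler_wpDr ?expR_ge0// ler_expR lerD2r.
  by rewrite ler_wnM2r ?lerB// ltW.
- rewrite ler_pdivlMl// -{1}(gtr0_norm e0) -normrM.
  have h1 := expR_ge1Dx (e * ln t).
  have h2 := expR_ge1Dx (- e * ln t).
  have := expR_ge0 (e * ln t); have := expR_ge0 (- e * ln t).
  by case: (ger0P (e * ln t)); lra.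
Qed.

Lemma integrable_EFinD D (f g : R -> R) : measurable D ->
  mu.-integrable D (EFin \o f) -> mu.-integrable D (EFin \o g) ->
  mu.-integrable D (EFin \o (fun t => f t + g t)).
Proof.
move=> mD ? ?.
by rewrite (_ : _ \o _ = (EFin \o f) \+ (EFin \o g))%E//; exact: integrableD.
Qed.

Lemma integrable_gamma_integrand_bound u v e : 0 < e -> e < u -> e < v ->
  mu.-integrable `]0, +oo[ (EFin \o (fun t =>
    e^-1 * (gamma_integrand (u + e) t + gamma_integrand (u - e) t
            + (gamma_integrand (v + e) t + gamma_integrand (v - e) t)))).
Proof.
move=> e0 eu ev.
have iD f g := @integrable_EFinD `]0, +oo[%classic f g (measurable_itv _).
have [? ? ? ?] : [/\ 0 < u + e, 0 < u - e, 0 < v + e & 0 < v - e].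
  by split; lra.
have := @integrableZl _ _ _ mu `]0, +oo[ _ e^-1 _
  (iD _ _ (iD _ _ (integrable_gamma_integrand _) (integrable_gamma_integrand _))
     (iD _ _ (integrable_gamma_integrand _) (integrable_gamma_integrand _))).
by apply.
Qed.

Lemma integrable_ln_gamma_integrand x : 0 < x ->
  mu.-integrable `]0, +oo[ (EFin \o (fun t => ln t * gamma_integrand x t)).
Proof.
move=> x0; have e0 : 0 < x / 2 by lra.
have ex : x / 2 < x by lra.
apply: le_integrable (integrable_gamma_integrand_bound e0 ex ex) => //.
  apply/measurable_EFinP/measurable_funM; last exact: measurable_gamma_integrand.
  by apply: measurable_funTS; exact: measurable_ln.
move=> t /=; rewrite in_itv/= andbT => t0; rewrite lee_fin.
apply: le_trans (norm_ln_gamma_integrand_le e0 (lexx x) (lexx x) t0) _.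
exact: ler_norm.
Qed.

(** Differentiation under the integral sign on the window ]x/2, 2x[. The margin e = x/4 keeps all
    four exponents of the dominating function positive, hence integrable. *)
Lemma is_derive_Gamma x : 0 < x ->
  is_derive x 1 (@Gamma R) (\int[mu]_(t in `]0, +oo[) (ln t * gamma_integrand x t)).
Proof.
move=> x0; have e0 : 0 < x / 4 by lra.
have eu : x / 4 < x / 2 by lra.
have ev : x / 4 < 2 * x by lra.
have xuv : `](x / 2), (2 * x)[%classic x by rewrite /= in_itv/=; apply/andP; split; lra.
have y0 y : `](x / 2), (2 * x)[%classic y -> 0 < y.
  by rewrite /= in_itv/= => /andP[? _]; lra.
have intf y : `](x / 2), (2 * x)[%classic y ->
    mu.-integrable `]0, +oo[ (EFin \o gamma_integrand y).
  by move=> /y0; exact: integrable_gamma_integrand.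
have d1 y t : `]0, +oo[%classic t ->
    is_derive y 1 (gamma_integrand ^~ t) (ln t * gamma_integrand y t).
  by rewrite /= in_itv/= andbT; exact: is_derive_gamma_integrand_param.
have derf y t : `](x / 2), (2 * x)[%classic y -> `]0, +oo[%classic t ->
    derivable (gamma_integrand ^~ t) y 1.
  by move=> _ /(d1 y) [].
have d1E y t : `]0, +oo[%classic t ->
    partial1of2 gamma_integrand y t = ln t * gamma_integrand y t.
  by move=> /(d1 y) [_]; rewrite partial1of2E.
have G0 t : 0 <= (x / 4)^-1 * (gamma_integrand (x / 2 + x / 4) t
   + gamma_integrand (x / 2 - x / 4) t
   + (gamma_integrand (2 * x + x / 4) t + gamma_integrand (2 * x - x / 4) t)).
  apply: mulr_ge0; first by rewrite invr_ge0 ltW.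
  by apply: addr_ge0; apply: addr_ge0; exact: gamma_integrand_ge0.
have Gub y t : `](x / 2), (2 * x)[%classic y -> `]0, +oo[%classic t ->
    `|partial1of2 gamma_integrand y t| <= (x / 4)^-1 *
      (gamma_integrand (x / 2 + x / 4) t + gamma_integrand (x / 2 - x / 4) t
   + (gamma_integrand (2 * x + x / 4) t + gamma_integrand (2 * x - x / 4) t)).
  move=> yuv t0; rewrite d1E//; move: yuv t0.
  rewrite /= !in_itv/= andbT => /andP[/ltW uy /ltW yv].
  exact: norm_ln_gamma_integrand_le.
have iG := integrable_gamma_integrand_bound e0 eu ev.
have mI := measurable_itv (Interval (BSide false (0 : R)) +oo%O).
split.
  exact: (@derivable_under_integral _ _ _ mu _ _ mI _ _ _ xuv intf derf _ G0 iG Gub).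
rewrite -derive1E.
rewrite (@differentiation_under_integral _ _ _ mu _ _ mI _ _ _ xuv intf derf _ G0 iG Gub).
by apply: eq_Rintegral => t; rewrite inE => /d1E ->.
Qed.

(* Jensen: integrate t^(y-x) >= e^c (1 + (y - x) ln t - c) against t^(x-1) e^-t. *)
Lemma Gamma_tangent c x y : 0 < x -> 0 < y ->
  expR c * ((1 - c) * Gamma x + (y - x) * derive1 (@Gamma R) x) <= Gamma y.
Proof.
move=> x0 y0; rewrite derive1E; case: (is_derive_Gamma x0) => _ ->.
have ix := integrable_gamma_integrand x0.
have iy := integrable_gamma_integrand y0.
have il := integrable_ln_gamma_integrand x0.
have mI := measurable_itv (Interval (BSide false (0 : R)) +oo%O).
have iZ k f : mu.-integrable `]0, +oo[ (EFin \o f) ->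
    mu.-integrable `]0, +oo[ (EFin \o (fun t => k * f t)).
  by move=> /(@integrableZl _ _ _ mu _ mI k).
have iD : mu.-integrable `]0, +oo[ (EFin \o (fun t =>
    (1 - c) * gamma_integrand x t + (y - x) * (ln t * gamma_integrand x t))).
  exact: (integrable_EFinD mI (iZ (1 - c) _ ix) (iZ (y - x) _ il)).
rewrite /Gamma -!RintegralZl// -RintegralD//; [|exact: iZ|exact: iZ].
rewrite -RintegralZl//; apply: le_Rintegral => //; first exact: iZ.
move=> t /=; rewrite in_itv/= andbT => t0.
rewrite -![_ `^ _ * expR (- t)]/(gamma_integrand _ _).
have -> : gamma_integrand y t =
    gamma_integrand x t * (expR c * expR ((y - x) * ln t - c)).
  by rewrite !gamma_integrandE// -!expRD; congr expR; ring.
rewrite (_ : (1 - c) * _ + _ =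
  gamma_integrand x t * (1 + ((y - x) * ln t - c))); last by ring.
rewrite mulrCA ler_wpM2l ?gamma_integrand_ge0// ler_wpM2l ?expR_ge0//.
exact: expR_ge1Dx.
Qed.

End gamma_function.

(** * Monotonicity and recurrence of digamma *)

Section digamma_function.
Context {R : realType}.
Implicit Types x y d : R.

Lemma derive1_Gamma x : 0 < x -> derive1 (@Gamma R) x = digamma x * Gamma x.
Proof. by move=> x0; rewrite /digamma divfK// gt_eqF// Gamma_gt0. Qed.

(** The graph of ln Gamma lies above its tangents: with c = (y - x) digamma x the bracket in
    [Gamma_tangent] collapses to Gamma x. *)
Lemma Gamma_ge_exp_digamma x y : 0 < x -> 0 < y ->
  expR ((y - x) * digamma x) * Gamma x <= Gamma y.
Proof.
move=> x0 y0; have := Gamma_tangent ((y - x) * digamma x) x0 y0.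
rewrite derive1_Gamma//; move: (digamma x) (Gamma x) => p g.
by rewrite (_ : (1 - _) * g + _ = g)//; ring.
Qed.

(** Chaining the tangent inequalities from x to y and from y to x leaves exp ((y - x) (digamma x -
    digamma y)) <= 1. *)
Lemma digamma_nondecreasing x y : 0 < x -> x <= y -> digamma x <= digamma y.
Proof.
move=> x0; rewrite le_eqVlt => /predU1P[->//|xy].
have y0 := lt_trans x0 xy.
have := Gamma_ge_exp_digamma x0 y0; have := Gamma_ge_exp_digamma y0 x0.
have := Gamma_gt0 x0; move: (digamma x) (digamma y) (Gamma x) (Gamma y).
move=> p q g h g0 h2 h1.
have : expR ((x - y) * q) * expR ((y - x) * p) * g <= 1 * g.
  by rewrite mul1r -mulrA; apply: le_trans h2; rewrite ler_wpM2l ?expR_ge0.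
rewrite ler_pM2r// -expRD -expR0 ler_expR.
rewrite (_ : _ + _ = (y - x) * (p - q)); last by ring.
by rewrite pmulr_rle0 ?subr_gt0// subr_le0.
Qed.

(** Logarithmic derivative of Gamma (z + 1) = z Gamma z. This equation is available for z > 0, hence
    near x, which is enough to equate the derivatives. *)
Lemma digammaD1 x : 0 < x -> digamma (x + 1) = digamma x + x^-1.
Proof.
move=> x0; have x10 : 0 < x + 1 by lra.
have dG := is_derive_Gamma x0.
have dG1 := is_derive_Gamma x10.
have G0 := Gamma_gt0 x0.
have G1 := GammaD1 x0.
have d1 : is_derive x 1 (fun z => z * Gamma z) (x * derive1 (@Gamma R) x + Gamma x).
  rewrite derive1E; apply: is_derive_eq; rewrite derive_val /GRing.scale/=.
  by rewrite mulr1.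
have d2 : is_derive x 1 (fun z => Gamma (z + 1)) (derive1 (@Gamma R) (x + 1)).
  rewrite derive1E.
  by apply: is_derive1_shift; apply: DeriveDef => //; case: dG1.
have : derive1 (@Gamma R) (x + 1) = x * derive1 (@Gamma R) x + Gamma x.
  case: d2 => _ <-; case: d1 => _ <-.
  apply: near_eq_derive => //; near=> z; rewrite GammaD1//.
  by near: z; exact: lt_nbhsr.
rewrite /digamma => ->; rewrite G1; field.
by rewrite !gt_eqF.
Unshelve. all: end_near. Qed.

End digamma_function.

(** * Completely monotone functions *)

Section completely_monotone_calculus.
Context {R : realType}.
Implicit Types (f g : R -> R) (s t x y c p : R).

(** Complete monotonicity on t > 0 up to order n. Each step gives a witness for minus the
    derivative, so every function of the chain is nonnegative and closure properties follow by
    induction without iterated derivatives. *)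
Fixpoint cm_upto n f : Prop :=
  (forall t, 0 < t -> 0 <= f t) /\
  if n is m.+1 then
    exists g, (forall t, 0 < t -> is_derive t 1 f (- g t)) /\ cm_upto m g
  else True.

Definition cm f := forall n, cm_upto n f.

Lemma cm_upto_ge0 n f t : cm_upto n f -> 0 < t -> 0 <= f t.
Proof. by case: n => [|n] [f0 _]; exact: f0. Qed.

Lemma cm_uptoS n f : cm_upto n.+1 f -> cm_upto n f.
Proof.
elim: n f => [|n IH] f [f0 [g [dg ng]]]; first by split.
by split=> //; exists g; split => //; exact: IH.
Qed.

Lemma is_derive_eq_pos f g t l : (forall t, 0 < t -> f t = g t) -> 0 < t ->
  is_derive t 1 f l -> is_derive t 1 g l.
Proof.
move=> fg t0; apply: near_eq_is_derive; near=> z; apply: fg.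
by near: z; exact: lt_nbhsr.
Unshelve. all: end_near. Qed.

Lemma eq_cm_upto n f g : (forall t, 0 < t -> f t = g t) ->
  cm_upto n f -> cm_upto n g.
Proof.
move=> fg; case: n => [|n] [f0 h]; split=> //; try by move=> t t0; rewrite -fg// f0.
case: h => h [dh nh]; exists h; split=> // t t0.
exact: (is_derive_eq_pos fg t0 (dh t t0)).
Qed.

Lemma cm_upto_cst n c : 0 <= c -> cm_upto n (cst c).
Proof.
elim: n c => [|n IH] c c0; split=> //.
exists (cst 0); split; last exact: IH.
by move=> t t0; apply: is_derive_eq; rewrite oppr0.
Qed.

Lemma cm_uptoD n f g : cm_upto n f -> cm_upto n g ->
  cm_upto n (fun t => f t + g t).
Proof.
elim: n f g => [|n IH] f g [f0 hf] [g0 hg]; split=> //.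
- by move=> t t0; rewrite addr_ge0 ?f0 ?g0.
- by move=> t t0; rewrite addr_ge0 ?f0 ?g0.
- case: hf hg => [f' [df nf]] [g' [dg ng]].
  exists (fun t => f' t + g' t); split; last exact: IH.
  move=> t t0; have := df t t0; have := dg t t0 => ? ?.
  by apply: is_derive_eq; rewrite opprD.
Qed.

(** By Leibniz, -(f g)' is a sum of two products of factors known to one order less, where the
    induction hypothesis applies. *)
Lemma cm_uptoM n f g : cm_upto n f -> cm_upto n g ->
  cm_upto n (fun t => f t * g t).
Proof.
elim: n f g => [|n IH] f g nf ng.
  by split=> // t t0; rewrite mulr_ge0// (cm_upto_ge0 nf, cm_upto_ge0 ng).
split; first by move=> t t0; rewrite mulr_ge0// ?(cm_upto_ge0 nf) ?(cm_upto_ge0 ng).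
have [nf' ng'] := (cm_uptoS nf, cm_uptoS ng).
case: nf ng => [_ [f' [df nf]]] [_ [g' [dg ng]]].
exists (fun t => f t * g' t + f' t * g t); split.
  move=> t t0; have := df t t0; have := dg t t0 => ? ?.
  by apply: is_derive_eq; rewrite /GRing.scale/=; ring.
by apply: cm_uptoD; exact: IH.
Qed.

Lemma cm_upto_shift n c f : 0 <= c -> cm_upto n f ->
  cm_upto n (fun t => f (t + c)).
Proof.
move=> c0; elim: n f => [|n IH] f [f0 nf].
  by split=> // t t0; apply: f0; rewrite ltr_wpDr.
split; first by move=> t t0; apply: f0; rewrite ltr_wpDr.
case: nf => g [dg ng]; exists (fun t => g (t + c)); split; last exact: IH.
by move=> t t0; apply: is_derive1_shift; apply: dg; rewrite ltr_wpDr.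
Qed.

Lemma cm_upto_powR n p : p <= 0 -> cm_upto n (fun t => t `^ p).
Proof.
elim: n p => [|n IH] p p0; first by split=> // t t0; exact: powR_ge0.
split; first by move=> t t0; exact: powR_ge0.
exists (fun t => - p * t `^ (p - 1)); split.
  move=> t t0; have ? := is_derive1_powR p t0.
  by apply: is_derive_eq; rewrite mulNr opprK.
apply: (cm_uptoM (cm_upto_cst n (_ : 0 <= - p))); first by rewrite oppr_ge0.
by apply: IH; lra.
Qed.

Lemma cm_upto_inv n c : 0 <= c -> cm_upto n (fun t => (t + c)^-1).
Proof.
move=> c0; have := cm_upto_shift c0 (cm_upto_powR n (lerN10 R)).
by apply: eq_cm_upto => t t0; rewrite powR_inv1// addr_ge0// ltW.
Qed.

Lemma is_derive_affine (a e : R) f F x l : 0 < x + a ->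
  (forall y, 0 < y + a -> f y = e * F (y + a)) ->
  is_derive (x + a) 1 F l -> is_derive x 1 f (e * l).
Proof.
move=> xa0 fF dF.
apply: (@near_eq_is_derive _ _ _ (fun z => e * F (z + a))).
  near=> z; rewrite fF// -ltrBlDr sub0r.
  by near: z; apply: lt_nbhsr; lra.
have ? := is_derive1_shift dF.
by apply: is_derive_eq.
Unshelve. all: end_near. Qed.

(* The sign e is tracked because differentiating turns e * F into (- e) * (- F'). *)
Lemma cm_upto_derive1n n (a e : R) f F : e ^+ 2 = 1 -> cm_upto n.+1 F ->
  (forall x, 0 < x + a -> f x = e * F (x + a)) ->
  forall x, 0 < x + a -> derivable (derive1n n f) x 1 /\
    0 <= (-1) ^+ n * e * derive1n n f x.
Proof.
move=> + + + x xa0; elim: n e f F => [|n IH] e f F e2 nF fF.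
  case: (nF) => _ [g [dg _]].
  split; first by case: (is_derive_affine xa0 fF (dg _ xa0)).
  by rewrite /= expr0 mul1r fF// mulrA -expr2 e2 mul1r (cm_upto_ge0 nF).
case: nF => _ [g [dg ng]].
rewrite derive1Sn (_ : (-1) ^+ n.+1 * e = (-1) ^+ n * - e); last first.
  by rewrite exprS mulN1r mulNr mulrN.
apply: (IH (- e) _ g) => //; first by rewrite sqrrN.
move=> y ya0; rewrite derive1E mulNr -mulrN.
by case: (is_derive_affine ya0 fF (dg _ ya0)).
Qed.

Lemma cm_completely_monotone (a : R) f F : cm F ->
  (forall x, 0 < x + a -> f x = F (x + a)) ->
  completely_monotone `]- a, +oo[ f.
Proof.
move=> nF fF n x; rewrite in_itv/= andbT => xa.
have xa0 : 0 < x + a by lra.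
have := @cm_upto_derive1n n a 1 f F (expr1n _ _) (nF n.+1) _ x xa0.
by rewrite mulr1; apply=> y ya; rewrite mul1r fF.
Qed.

End completely_monotone_calculus.

(** * Taylor estimates and series of completely monotone functions *)

Section completely_monotone_series.
Context {R : realType}.
Implicit Types (f g : R -> R) (s t x y h : R).

(** A quadratic remainder bound survives pointwise limits, so it serves to differentiate a
    series. *)
Lemma is_derive1_quadratic f t l d C : 0 < d ->
  (forall h, `|h| <= d -> `|f (t + h) - f t - h * l| <= C * h ^+ 2) ->
  is_derive t 1 f l.
Proof.
move=> d0 H.
have dl : h^-1 *: (f (h *: (1 : R) + t) - f t) @[h --> 0^'] --> l.
  apply/cvgrPdist_le => e e0.
  have C0 : 0 < `|C| + 1 by rewrite ltr_wpDl.
  near=> h.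
  have h0 : h != 0 by near: h; exact: nbhs_dnbhs_neq.
  have hd : `|h| <= d by near: h; exact: (@dnbhs0_le _ _ _ d0).
  have he : `|h| <= e / (`|C| + 1) by near: h; apply: dnbhs0_le; rewrite divr_gt0.
  have nh0 : 0 < `|h| by rewrite normr_gt0.
  rewrite /GRing.scale/= mulr1 (addrC h).
  have -> : l - h^-1 * (f (t + h) - f t) = - (h^-1 * (f (t + h) - f t - h * l)).
    by field.
  rewrite normrN normrM normfV ler_pdivrMl//.
  apply: le_trans (H h hd) _; rewrite -real_normK ?num_real// expr2 mulrCA ler_wpM2l//.
  apply: le_trans (_ : (`|C| + 1) * `|h| <= e); last by rewrite mulrC -ler_pdivlMr.
  by rewrite ler_wpM2r// (le_trans (ler_norm C))// lerDl.
apply: DeriveDef; first by apply/cvg_ex; exists l.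
by rewrite /derive; apply/cvg_lim.
Unshelve. all: end_near. Qed.

(** Derivatives are unique, so the witnesses chosen at the different orders all agree with
    [- derive1 f] on t > 0. *)
Lemma cm_derive1 f : cm f ->
  cm (fun t => - derive1 f t) /\
  forall t, 0 < t -> is_derive t 1 f (- (- derive1 f t)).
Proof.
move=> nf; split=> [n|t t0].
  have [_ [g [dg ng]]] := nf n.+1.
  apply: eq_cm_upto ng => t t0; have [_] := dg t t0.
  by rewrite derive1E => ->; rewrite opprK.
have [_ [g [dg _]]] := nf 1%N; rewrite opprK derive1E.
by apply: DeriveDef => //; case: (dg t t0).
Qed.

Lemma pos_MVT f df x y : (forall t, 0 < t -> is_derive t 1 f (df t)) ->
  0 < x -> x <= y ->
  exists c, [/\ x <= c, c <= y & f y - f x = df c * (y - x)].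
Proof.
move=> dfE x0 xy.
have pos z : x <= z -> 0 < z by exact: lt_le_trans.
have [||c] := @MVT_segment R f df x y xy.
- by move=> z; rewrite in_itv/= => /andP[/ltW/pos zp _]; exact: dfE.
- apply: derivable_within_continuous => z.
  by rewrite in_itv/= => /andP[/pos zp _]; case: (dfE z zp).
- by rewrite in_itv/= => /andP[xc cy] E; exists c.
Qed.

Lemma cm_nonincreasing f x y : cm_upto 1 f -> 0 < x -> x <= y -> f y <= f x.
Proof.
move=> [_ [g [dg [g0 _]]]] x0 xy.
have [c [xc _ E]] := pos_MVT dg x0 xy.
rewrite -subr_le0 E mulNr oppr_le0 mulr_ge0 ?subr_ge0//. apply: g0; exact: lt_le_trans xc.
Qed.

Lemma cm_slope f x y : cm f -> 0 < x -> x <= y ->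
  - derive1 f y * (y - x) <= f x - f y <= - derive1 f x * (y - x).
Proof.
move=> nf x0 xy; have [ng dg] := cm_derive1 nf.
have [c [xc cy E]] := pos_MVT dg x0 xy.
have c0 := lt_le_trans x0 xc.
have -> : f x - f y = - derive1 f c * (y - x) by rewrite -opprB E opprK mulNr.
apply/andP; split; apply: ler_wpM2r; rewrite ?subr_ge0//.
- exact: (cm_nonincreasing (ng 1%N) c0 cy).
- exact: (cm_nonincreasing (ng 1%N) x0 xc).
Qed.

(** Since -f' is nonincreasing, its value at t is at most the mean decrease of f over [t/2, t]. This
    bounds a series of derivatives by the series itself. *)
Lemma cm_derive1_le f t : cm f -> 0 < t -> - derive1 f t <= 2 / t * f (t / 2).
Proof.
move=> nf t0; have t20 : 0 < t / 2 by lra.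
have tt : t / 2 <= t by lra.
have /andP[+ _] := cm_slope nf t20 tt.
have := cm_upto_ge0 (nf 0) t0 => f0 h.
have -> : - derive1 f t = 2 / t * (- derive1 f t * (t - t / 2)).
  by field; rewrite gt_eqF.
by apply: ler_wpM2l; [rewrite divr_ge0// ltW|apply: le_trans h _; rewrite lerBlDr lerDl].
Qed.

(** Convexity gives the lower bound. For the upper one, t and t + h are at least t/2 and f'' is
    nonincreasing, so f'' (t/2) controls the variation of f'. *)
Lemma cm_taylor f t h : cm f -> 0 < t -> `|h| <= t / 2 ->
  0 <= f (t + h) - f t - h * derive1 f t <=
    - derive1 (fun t => - derive1 f t) (t / 2) * h ^+ 2.
Proof.
move=> nf t0; rewrite ler_norml => /andP[h1 h2].
have [ng dg] := cm_derive1 nf.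
have slopef := cm_slope nf; have slopeg := cm_slope ng.
have t20 : 0 < t / 2 by lra.
have qle z : t / 2 <= z -> - derive1 (fun t => - derive1 f t) z <=
    - derive1 (fun t => - derive1 f t) (t / 2).
  exact: (cm_nonincreasing ((cm_derive1 ng).1 1%N)).
(* After generalization [g] is f' and [- q] is f''. *)
move: (derive1 (fun t => - derive1 f t)) slopeg qle => q.
move: (derive1 f) slopef => g slopef slopeg qle {nf ng dg}.
have th0 : 0 < t + h by lra.
have [h0|h0] := leP 0 h.
- have tth : t <= t + h by lra.
  have /andP[f1 f2] := slopef _ _ t0 tth.
  have /andP[_ g2] := slopeg _ _ t0 tth.
  have q1 : - q t * h ^+ 2 <= - q (t / 2) * h ^+ 2.
    by rewrite ler_wpM2r ?sqr_ge0// qle//; lra.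
  have := ler_wpM2l h0 g2; move: f1 f2 q1 {g2}.
  move: (f t) (f (t + h)) (g t) (g (t + h)) (q t) (q (t / 2)).
  by move=> *; apply/andP; split; lra.
- have tth : t + h <= t by lra.
  have /andP[f1 f2] := slopef _ _ th0 tth.
  have /andP[_ g2] := slopeg _ _ th0 tth.
  have q1 : - q (t + h) * h ^+ 2 <= - q (t / 2) * h ^+ 2.
    by rewrite ler_wpM2r ?sqr_ge0// qle//; lra.
  have := ler_wnM2l (ltW h0) g2; move: f1 f2 q1 {g2}.
  move: (f t) (f (t + h)) (g t) (g (t + h)) (q (t + h)) (q (t / 2)).
  by move=> *; apply/andP; split; lra.
Qed.

End completely_monotone_series.

Section completely_monotone_series_limit.
Context {R : realType}.
Implicit Types (f : nat -> R -> R) (F : R -> R) (t : R).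

Lemma series_cm_le f F t n : (forall k, cm (f k)) -> 0 < t ->
  series (f^~ t) @ \oo --> F t -> series (f^~ t) n <= F t.
Proof.
move=> nf t0 cF; rewrite -(cvg_lim _ cF)//.
apply: nondecreasing_cvgn_le; last by apply/cvg_ex; exists (F t).
apply: nondecreasing_series => k _ _; exact: cm_upto_ge0 (nf k 0) t0.
Qed.

(** The terms are nonnegative and [cm_derive1_le] bounds the partial sums by (2 / t) F (t / 2). *)
Lemma is_cvg_series_derive1 f F t : (forall k, cm (f k)) -> 0 < t ->
  series (f^~ (t / 2)) @ \oo --> F (t / 2) ->
  cvgn (series (fun k => - derive1 (f k) t)).
Proof.
move=> nf t0 cF; have t20 : 0 < t / 2 by lra.
apply: nondecreasing_is_cvgn.
  apply: nondecreasing_series => k _ _.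
  exact: cm_upto_ge0 ((cm_derive1 (nf k)).1 0) t0.
exists (2 / t * F (t / 2)) => _ [n _ <-].
apply: le_trans (_ : 2 / t * series (f^~ (t / 2)) n <= _).
  rewrite /series/= big_distrr/=; apply: ler_sum => k _.
  exact: cm_derive1_le.
by rewrite ler_wpM2l ?divr_ge0 ?(ltW t0)// series_cm_le.
Qed.

(** Sum the Taylor estimates of the terms and let n tend to infinity with h fixed. The quadratic
    constant is the sum of the second derivatives at t/2. *)
Lemma is_derive_series f F t : (forall k, cm (f k)) -> 0 < t ->
  (forall t, 0 < t -> series (f^~ t) @ \oo --> F t) ->
  is_derive t 1 F (- limn (series (fun k => - derive1 (f k) t))).
Proof.
move=> nf t0 cF; have t20 : 0 < t / 2 by lra.
pose g k t := - derive1 (f k) t.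
pose q k t := - derive1 (g k) t.
have ng k : cm (g k) := (cm_derive1 (nf k)).1.
have nq k : cm (q k) := (cm_derive1 (ng k)).1.
have cg t' : 0 < t' -> series (g^~ t') @ \oo --> limn (series (g^~ t')).
  move=> t'0; have t'20 : 0 < t' / 2 by lra.
  exact: (is_cvg_series_derive1 nf t'0 (cF _ t'20)).
have cq : series (q^~ (t / 2)) @ \oo --> limn (series (q^~ (t / 2))).
  have t40 : 0 < t / 2 / 2 by lra.
  exact: (is_cvg_series_derive1 (F := fun t => limn (series (g^~ t))) ng t20 (cg _ t40)).
apply: (is_derive1_quadratic t20 (C := limn (series (q^~ (t / 2))))) => h hd.
have th0 : 0 < t + h by move: hd; rewrite ler_norml => /andP[]; lra.
have cl : series (f^~ (t + h)) n - series (f^~ t) n + h * series (g^~ t) n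
    @[n --> \oo] --> F (t + h) - F t - h * - limn (series (g^~ t)).
  rewrite mulrN opprK; apply: cvgD; first by apply: cvgB; exact: cF.
  by apply: cvgMl_tmp; exact: cg.
have cr : series (q^~ (t / 2)) n * h ^+ 2 @[n --> \oo] -->
    limn (series (q^~ (t / 2))) * h ^+ 2 by apply: cvgMr_tmp.
have bound n : 0 <= series (f^~ (t + h)) n - series (f^~ t) n + h * series (g^~ t) n
    <= series (q^~ (t / 2)) n * h ^+ 2.
  rewrite /series/= big_distrr big_distrl/= -sumrB -big_split/=.
  apply/andP; split; [apply: sumr_ge0|apply: ler_sum] => k _.
    by have /andP[+ _] := cm_taylor (nf k) t0 hd; rewrite mulrN.
  by have /andP[_ +] := cm_taylor (nf k) t0 hd; rewrite mulrN.
have l0 : 0 <= F (t + h) - F t - h * - limn (series (g^~ t)).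
  apply: (cvgr_to_ge cl); apply/nearW => n; by have /andP[] := bound n.
rewrite ger0_norm//.
apply: (ler_cvg_to cl cr); apply/nearW => n; by have /andP[] := bound n.
Qed.

(** Induction on the order: the negated derivatives of the terms form a convergent series of the
    same kind. *)
Lemma cm_series f F : (forall k, cm (f k)) ->
  (forall t, 0 < t -> series (f^~ t) @ \oo --> F t) -> cm F.
Proof.
move=> + + n; elim: n f F => [|n IH] f F nf cF.
  split=> // t t0; apply: (cvgr_to_ge (cF t t0)); apply/nearW => m.
  by rewrite /series/= sumr_ge0// => k _; exact: cm_upto_ge0 (nf k 0) t0.
split.
  move=> t t0; apply: (cvgr_to_ge (cF t t0)); apply/nearW => m.
  by rewrite /series/= sumr_ge0// => k _; exact: cm_upto_ge0 (nf k 0) t0.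
exists (fun t => limn (series (fun k => - derive1 (f k) t))); split.
  by move=> t t0; exact: is_derive_series.
apply: (IH (fun k t => - derive1 (f k) t)) => [k|t t0].
  exact: (cm_derive1 (nf k)).1.
have t20 : 0 < t / 2 by lra.
exact: (is_cvg_series_derive1 nf t0 (cF _ t20)).
Qed.

End completely_monotone_series_limit.

(** * Increments of a nondecreasing solution of psi (x + 1) = psi x + 1/x *)

Section monotone_digamma.
Context {R : realType} (psi : R -> R).
Context (psi_nondecreasing : forall x y : R, 0 < x -> x <= y -> psi x <= psi y).
Context (psiD1 : forall x : R, 0 < x -> psi (x + 1) = psi x + x^-1).
Implicit Types (d s t alpha beta : R) (v : R -> R).

Lemma cvg_shift_inv t : ((t + n%:R)^-1 : R) @[n --> \oo] --> (0 : R).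
Proof.
apply/gtr0_cvgV0.
  near=> n; have nt : - t < n%:R by near: n; exact: nbhs_infty_gtr.
  by lra.
exact: (cvg_comp _ _ cvgr_idn (@cvg_addrl R t)).
Unshelve. all: end_near. Qed.

(** Monotonicity places psi (t + d) between psi t and psi (t + 1) = psi t + 1/t. *)
Lemma psi_sub_bounds d t : 0 <= d -> d <= 1 -> 0 < t ->
  0 <= psi (t + d) - psi t <= t^-1.
Proof.
move=> d0 d1 t0; rewrite subr_ge0 psi_nondecreasing ?lerDl//=.
rewrite lerBlDl -psiD1//; apply: psi_nondecreasing; first by lra.
by rewrite lerD2l.
Qed.

Lemma psi_sub_telescope d t : 0 <= d -> 0 < t ->
  psi (t + d) - psi t - (psi (t + 1 + d) - psi (t + 1)) =
  d / (t * (t + d)).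
Proof.
move=> d0 t0; have td0 : 0 < t + d by lra.
rewrite (addrAC t) !psiD1//; field.
by rewrite !gt_eqF.
Qed.

Lemma cvg_psi_sub d t : 0 <= d -> d <= 1 -> 0 < t ->
  psi (t + n%:R + d) - psi (t + n%:R) @[n --> \oo] --> (0 : R).
Proof.
move=> d0 d1 t0.
apply: (@squeeze_cvgr _ _ _ _ (cst 0) _ _ _ _ _ (cvg_shift_inv t)); last exact: cvg_cst.
by apply/nearW => n; apply: psi_sub_bounds => //; rewrite ltr_wpDr.
Qed.

Lemma nonincreasing_cvg0_ge0 (w : R^nat) :
  (forall n, w n.+1 <= w n) -> w @ \oo --> (0 : R) -> 0 <= w 0%N.
Proof.
move=> /nonincreasing_seqP nw cw.
by have := nonincreasing_cvgn_ge nw (cvgP _ cw) 0%N; rewrite (cvg_lim _ cw).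
Qed.

(** Comparison principle: along t, t + 1, t + 2, ... the increment of psi minus v is nonincreasing
    and tends to 0, so it starts nonnegative. *)
Lemma psi_sub_ge d v t : 0 <= d -> d <= 1 -> 0 < t ->
  (forall s, t <= s -> v s - v (s + 1) <= d / (s * (s + d))) ->
  v (t + n%:R) @[n --> \oo] --> (0 : R) ->
  v t <= psi (t + d) - psi t.
Proof.
move=> d0 d1 t0 vS v0; rewrite -subr_ge0.
have := @nonincreasing_cvg0_ge0 (fun n =>
  psi (t + n%:R + d) - psi (t + n%:R) - v (t + n%:R)).
rewrite /= addr0; apply=> [n|].
  have tn0 : 0 < t + n%:R by rewrite ltr_wpDr.
  rewrite -natr1 addrA; have := psi_sub_telescope d0 tn0.
  have /vS : t <= t + n%:R by rewrite lerDl.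
  by lra.
by rewrite -[X in _ --> X](subrr (0 : R)); apply: cvgB => //; exact: cvg_psi_sub.
Qed.

Lemma psi_sub_le d v t : 0 <= d -> d <= 1 -> 0 < t ->
  (forall s, t <= s -> d / (s * (s + d)) <= v s - v (s + 1)) ->
  v (t + n%:R) @[n --> \oo] --> (0 : R) ->
  psi (t + d) - psi t <= v t.
Proof.
move=> d0 d1 t0 vS v0; rewrite -subr_ge0.
have := @nonincreasing_cvg0_ge0 (fun n =>
  v (t + n%:R) - (psi (t + n%:R + d) - psi (t + n%:R))).
rewrite /= addr0; apply=> [n|].
  have tn0 : 0 < t + n%:R by rewrite ltr_wpDr.
  rewrite -natr1 addrA; have := psi_sub_telescope d0 tn0.
  have /vS : t <= t + n%:R by rewrite lerDl.
  by lra.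
by rewrite -[X in _ --> X](subrr (0 : R)); apply: cvgB => //; exact: cvg_psi_sub.
Qed.

(** The comparison function [v] has the first two terms of the expansion of the increment at
    infinity, d / t + d (1 - d) / (2 t^2), with t (t + 1) in place of t^2 so that its unit
    differences are simple. *)
Lemma psi_sub_lower d t : 0 < d -> d < 1 -> 0 < t ->
  d / t + d * (1 - d) / 2 / (t * (t + 1)) <= psi (t + d) - psi t.
Proof.
move=> d0 d1 t0.
pose v s := d * s^-1 + d * (1 - d) / 2 * (s^-1 * (s + 1)^-1).
have -> : d / t + d * (1 - d) / 2 / (t * (t + 1)) = v t.
  by rewrite /v; field; rewrite !gt_eqF//; lra.
apply: psi_sub_ge => //; try exact: ltW.
- move=> s ts; have s0 := lt_le_trans t0 ts.
  have [s1 s2 sd] : [/\ 0 < s + 1, 0 < s + 1 + 1 & 0 < s + d] by split; lra.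
  have s3 : 0 < s + 2 by lra.
  rewrite -subr_ge0.
  rewrite (_ : _ - _ = d * (1 - d) * (2 - d) / (s * (s + 1) * (s + d) * (s + 2))).
    by rewrite divr_ge0 ?mulr_ge0 ?(ltW s0) ?(ltW s1) ?(ltW sd) ?(ltW s3)//; lra.
  by rewrite /v; field; rewrite !gt_eqF.
- rewrite (_ : 0 = d * 0 + d * (1 - d) / 2 * (0 * 0) :> R); last by rewrite !mulr0 addr0.
  apply: cvgD; apply: cvgMl_tmp; first exact: cvg_shift_inv.
  apply: cvgM; first exact: cvg_shift_inv.
  under eq_fun do rewrite addrAC; exact: cvg_shift_inv.
Qed.

(** Compare with d / (s - 1), whose unit decrement d / ((s - 1) s) exceeds d / (s (s + d)). *)
Lemma psi_sub_upper d t : 0 < d -> d < 1 -> 1 < t ->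
  psi (t + d) - psi t <= d / (t - 1).
Proof.
move=> d0 d1 t1; have t0 : 0 < t by lra.
apply: (@psi_sub_le d (fun s => d / (s - 1))) => //; try exact: ltW.
- move=> s ts; rewrite addrK.
  have [s0 s1 sd] : [/\ 0 < s, 0 < s - 1 & 0 < s + d] by split; lra.
  rewrite -subr_ge0 (_ : _ - _ = d * (d + 1) / ((s - 1) * s * (s + d))).
    by rewrite divr_ge0 ?mulr_ge0 ?(ltW s0) ?(ltW s1) ?(ltW sd)//; lra.
  by field; rewrite !gt_eqF.
- rewrite -[X in _ --> X](mulr0 d); apply: cvgMl_tmp.
  under eq_fun do rewrite addrAC; exact: cvg_shift_inv.
Qed.

(** Term of the series for t (psi (t + d) - psi t) - d, kept as a product of factors 1 / (t + c) so
    that complete monotonicity can be read off for 0 < d < 1. *)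
Definition psi_sub_term d (m : nat) t :=
  m.+1%:R * (d * (1 - d)) *
    ((t + (m%:R + d))^-1 * ((t + m.+1%:R)^-1 * (t + (m.+1%:R + d))^-1)).

(* Summation by parts of [psi_sub_telescope]. *)
Lemma series_psi_sub_term d t N : 0 < d -> 0 < t ->
  series (fun m => psi_sub_term d m t) N =
  t * (psi (t + d) - psi t)
  - t * (psi (t + N%:R + d) - psi (t + N%:R))
  - (N%:R / (t + N%:R) - (1 - d) * (N%:R / (t + N%:R + d))).
Proof.
move=> d0 t0; rewrite /series/=; elim: N => [|N IH].
  by rewrite big_geq// addr0 !mul0r mulr0 !subr0 subrr.
rewrite big_nat_recr//= {}IH /psi_sub_term -natr1.
have N0 : 0 <= N%:R :> R by [].
move: (N%:R) N0 => n n0; rewrite !addrA.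
have tn0 : 0 < t + n by lra.
have /eqP := psi_sub_telescope (ltW d0) tn0.
rewrite subr_eq => /eqP ->.
field.
by rewrite !gt_eqF//; lra.
Qed.

(** In the partial sums the shifted increment tends to 0 and both quotients tend to 1, leaving the
    constant 1 - (1 - d) = d. *)
Lemma cvg_series_psi_sub d t : 0 < d -> d < 1 -> 0 < t ->
  series (fun m => psi_sub_term d m t) @ \oo -->
  t * (psi (t + d) - psi t) - d.
Proof.
move=> d0 d1 t0.
have /funext -> := fun N => series_psi_sub_term N d0 t0.
have cN c : 0 < c -> (n%:R / (c + n%:R) : R) @[n --> \oo] --> (1 : R).
  move=> c0.
  have -> : (fun n : nat => (n%:R / (c + n%:R) : R)) =
      (fun n : nat => 1 - c * (c + n%:R)^-1).
    apply/funext => n; have n0 : 0 <= n%:R :> R by [].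
    by field; rewrite gt_eqF//; lra.
  rewrite -[X in _ --> X](subr0 (1 : R)); apply: cvgB; first exact: cvg_cst.
  by rewrite -[X in _ --> X](mulr0 c); apply: cvgMl_tmp; exact: cvg_shift_inv.
rewrite [X in _ --> X](_ : _ =
  t * (psi (t + d) - psi t) - t * 0 - (1 - (1 - d) * 1)); last by ring.
apply: cvgB; [apply: cvgB|apply: cvgB].
- exact: cvg_cst.
- by apply: cvgMl_tmp; apply: cvg_psi_sub => //; exact: ltW.
- exact: cN.
- apply: cvgMl_tmp; under eq_fun do rewrite addrAC.
  by apply: cN; lra.
Qed.

Lemma cm_psi_sub d : 0 < d -> d < 1 ->
  cm (fun t => t * (psi (t + d) - psi t) - d).
Proof.
move=> d0 d1; apply: (@cm_series _ (psi_sub_term d)); last first.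
  by move=> t t0; exact: cvg_series_psi_sub.
move=> m n; apply: cm_uptoM.
  by apply: cm_upto_cst; rewrite !mulr_ge0//; lra.
have m0 : 0 <= m%:R :> R by [].
apply: cm_uptoM; first by apply: cm_upto_inv; lra.
apply: cm_uptoM; apply: cm_upto_inv => //.
by rewrite -natr1; lra.
Qed.

(** * The function f in the variable t = x + a, with d = b - a *)

Definition psi_ratio d alpha beta t :=
  t `^ alpha * (psi (t + d) - psi t - beta / t).

Lemma psi_ratioE d alpha beta t : 0 < t -> psi_ratio d alpha beta t =
  t `^ (alpha - 1) * (t * (psi (t + d) - psi t) - beta).
Proof.
move=> t0; rewrite /psi_ratio -[in LHS](subrK 1 alpha).
have t_neq0 : t != 0 by rewrite gt_eqF.
rewrite (@powRD _ t (alpha - 1) 1) ?t_neq0 ?implybT// powRr1 ?ltW//.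
by rewrite -mulrA; congr (_ * _); field.
Qed.

Lemma psi_ratio0E alpha beta t : 0 < t ->
  psi_ratio 0 alpha beta t = - beta * t `^ (alpha - 1).
Proof. by move=> t0; rewrite psi_ratioE// addr0 subrr mulr0 sub0r mulrC. Qed.

Lemma psi_ratio1E alpha beta t : 0 < t ->
  psi_ratio 1 alpha beta t = (1 - beta) * t `^ (alpha - 1).
Proof.
move=> t0; rewrite psi_ratioE// psiD1// addrAC subrr add0r.
by rewrite divff ?gt_eqF// mulrC.
Qed.

(** A power with nonpositive exponent times the sum of the constant d - beta >= 0 and the completely
    monotone series. *)
Lemma cm_psi_ratio d alpha beta : 0 < d -> d < 1 -> beta <= d -> alpha <= 1 ->
  cm (psi_ratio d alpha beta).
Proof.
move=> d0 d1 bd al n; apply: (@eq_cm_upto _ _ (fun t => t `^ (alpha - 1) *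
  (d - beta + (t * (psi (t + d) - psi t) - d)))).
  by move=> t t0; rewrite psi_ratioE//; congr (_ * _); ring.
apply: cm_uptoM; first by apply: cm_upto_powR; rewrite subr_le0.
by apply: cm_uptoD; [apply: cm_upto_cst; rewrite subr_ge0|exact: cm_psi_sub].
Qed.

Lemma psi_ratio_ge d alpha beta t : 0 < d -> d < 1 -> 0 < t ->
  (d - beta) * t `^ (alpha - 1) <= psi_ratio d alpha beta t.
Proof.
move=> d0 d1 t0; rewrite psi_ratioE// mulrC ler_wpM2l ?powR_ge0// lerB//.
by rewrite -subr_ge0; exact: cm_upto_ge0 (cm_psi_sub d0 d1 0) t0.
Qed.

(** At beta = d the leading terms cancel and the second-order term of [psi_sub_lower] remains. The
    1/4 comes from t (t + 1) <= 2 t^2 for t >= 1. *)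
Lemma psi_ratio_ge_critical d alpha t : 0 < d -> d < 1 -> 1 <= t ->
  d * (1 - d) / 4 * t `^ (alpha - 2) <= psi_ratio d alpha d t.
Proof.
move=> d0 d1 t1; have t0 : 0 < t by lra.
rewrite /psi_ratio powRB ?(gt_eqF t0) ?implybT//.
rewrite powR_mulrn ?(ltW t0)// mulrCA ler_wpM2l ?powR_ge0//.
have := psi_sub_lower d0 d1 t0; rewrite -lerBrDl; apply: le_trans.
rewrite (_ : d * (1 - d) / 2 / _ = d * (1 - d) / 4 * (2 / (t * (t + 1)))); last first.
  by field; rewrite !gt_eqF//; lra.
rewrite ler_pM2l; last by rewrite divr_gt0// mulr_gt0//; lra.
rewrite ler_pdivlMr; last by rewrite mulr_gt0//; lra.
rewrite mulrC ler_pdivrMr ?exprn_gt0// expr2; nra.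
Qed.

(** As t decreases to d, psi (t - d) tends to minus infinity like -1 / (t - d) while the other terms
    stay bounded. *)
Lemma psi_ratio_lt0_neg d alpha : 0 < d ->
  exists2 t, d < t & psi_ratio (- d) alpha (- d) t < 0.
Proof.
move=> d0; pose K := psi 2 - psi d.
(* With 1/s = |K| + 2 the bracket is at most K - |K| - 1, since d / (s + d) <= 1. *)
pose s := (`|K| + 2)^-1; have K0 := normr_ge0 K.
have s0 : 0 < s by rewrite invr_gt0; lra.
have s1 : s <= 1 by rewrite invf_le1; lra.
exists (s + d); first by lra.
rewrite /psi_ratio addrK pmulr_rlt0; last by rewrite powR_gt0; lra.
have h1 : psi s = psi (s + 1) - `|K| - 2 by rewrite psiD1// /s invrK; ring.
have h2 : psi (s + 1) <= psi 2 by apply: psi_nondecreasing; lra.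
have h3 : psi d <= psi (s + d) by apply: psi_nondecreasing; lra.
have h4 : d / (s + d) <= 1 by rewrite ler_pdivrMr; lra.
by have := ler_norm K; rewrite {1}/K mulNr; lra.
Qed.

(** Near 0, -psi t contributes 1/t, so the bracket behaves like (1 - d) / t. *)
Lemma psi_ratio_lt0_gt1 d alpha : 1 < d ->
  exists2 t, 0 < t & psi_ratio d alpha d t < 0.
Proof.
move=> d1; pose K := psi (1 + d) - psi 1.
(* Chosen so that (d - 1) / s = |K| + d, which brings the bracket down to at most K - |K| - d. *)
pose s := (d - 1) / (`|K| + d); have K0 := normr_ge0 K.
have s0 : 0 < s by rewrite divr_gt0//; lra.
have s1 : s <= 1 by rewrite ler_pdivrMr; lra.
exists s => //; rewrite /psi_ratio pmulr_rlt0 ?powR_gt0//.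
have h1 : psi s = psi (s + 1) - s^-1 by rewrite psiD1// addrK.
have h2 : d / s = `|K| + d + s^-1.
  by rewrite /s; field; apply/andP; split; rewrite gt_eqF//; lra.
have h3 : psi (s + d) <= psi (1 + d) by apply: psi_nondecreasing; lra.
have h4 : psi 1 <= psi (s + 1) by apply: psi_nondecreasing; lra.
by have := ler_norm K; rewrite h2 {1}/K; lra.
Qed.

(** At large t the product t (psi (t + d) - psi t) is close to d < beta. The upper bound d t / (t -
    1) falls below beta once (beta - d) t > beta, and the chosen t gives beta + 1. *)
Lemma psi_ratio_lt0_beta d alpha beta : 0 < d -> d < 1 -> d < beta ->
  exists2 t, 0 < t & psi_ratio d alpha beta t < 0.
Proof.
move=> d0 d1 db; pose t := (beta + 1) / (beta - d).
have t1 : 1 < t by rewrite ltr_pdivlMr; lra.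
have t0 : 0 < t by lra.
exists t => //; rewrite /psi_ratio pmulr_rlt0 ?powR_gt0// subr_lt0.
apply: le_lt_trans (psi_sub_upper d0 d1 t1) _.
rewrite ltr_pdivrMr ?subr_gt0// mulrAC ltr_pdivlMr//.
have : (beta - d) * t = beta + 1 by rewrite /t mulrC divfK// gt_eqF// subr_gt0.
by lra.
Qed.

End monotone_digamma.

(** * Completely monotone functions on a shifted half-line *)

Section completely_monotone_itv.
Context {R : realType}.
Implicit Types (a alpha c p s t x : R) (f : R -> R).

Lemma powR_unbounded c p (K : R) : 0 < c -> 0 < p ->
  exists2 t, 1 <= t & K < c * t `^ p.
Proof.
move=> c0 p0; pose L := `|K| / (c * p).
have L0 : 0 <= L by rewrite divr_ge0// mulr_ge0 ?ltW.
exists (expR L); first by rewrite -expR0 ler_expR.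
rewrite /powR gt_eqF ?expR_gt0// expRK.
apply: lt_le_trans (_ : c * (1 + p * L) <= _); last first.
  by rewrite ler_pM2l// expR_ge1Dx.
rewrite /L (_ : _ * _ = c + `|K|); last by field; rewrite !gt_eqF.
by rewrite (le_lt_trans (ler_norm K))// ltrDr.
Qed.

Lemma cm_itv_ge0 a f : completely_monotone `]- a, +oo[ f ->
  forall t, 0 < t -> 0 <= f (t - a).
Proof.
move=> cmf t t0; have := (cmf 0%N (t - a)).
rewrite in_itv/= andbT expr0 mul1r => H.
by have [|] := H; lra.
Qed.

Lemma cm_itv_nonincreasing a f : completely_monotone `]- a, +oo[ f ->
  forall s t, 0 < s -> s <= t -> f (t - a) <= f (s - a).
Proof.
move=> cmf s t s0 st.
have xa (u : R) : 0 < u -> u - a \in `]- a, +oo[%R.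
  by move=> u0; rewrite in_itv/= andbT; lra.
have df (u : R) : 0 < u -> is_derive u 1 (fun z => f (z - a)) (derive1 f (u - a)).
  move=> u0; apply: is_derive1_shift; rewrite derive1E.
  by apply: DeriveDef => //; case: (cmf 0%N _ (xa u u0)).
have [c [sc _ E]] := pos_MVT df s0 st.
have [_ +] := cmf 1%N _ (xa c (lt_le_trans s0 sc)).
rewrite /= expr1 mulN1r oppr_ge0 => f'0.
by rewrite -subr_le0 E mulr_le0_ge0// subr_ge0.
Qed.

(** On t >= 1 a nonincreasing function stays below its value at t = 1, so it cannot dominate an
    unbounded power. *)
Lemma cm_itv_growth a f c p : completely_monotone `]- a, +oo[ f -> 0 < c ->
  (forall t, 1 <= t -> c * t `^ p <= f (t - a)) -> p <= 0.
Proof.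
move=> cmf c0 fge; rewrite leNgt; apply/negP => p0.
have [t t1] := powR_unbounded (f (1 - a)) c0 p0.
by apply/negP; rewrite -leNgt (le_trans (fge t t1))// (cm_itv_nonincreasing cmf).
Qed.

(** Settles the cases b = a and b = a + 1, where f is a multiple of one power. The sign of c is read
    at t = 1, and c = 0 is the case of arbitrary alpha. *)
Lemma cm_itv_powRP a f alpha c :
  (forall x, 0 < x + a -> f x = c * (x + a) `^ (alpha - 1)) ->
  completely_monotone `]- a, +oo[ f <-> c = 0 \/ (0 < c /\ alpha <= 1).
Proof.
move=> fE; split=> [cmf|[c0|[c0 a1]]].
- have fE' t : 0 < t -> f (t - a) = c * t `^ (alpha - 1).
    by move=> t0; rewrite fE subrK.
  have := cm_itv_ge0 cmf ltr01.
  rewrite fE' ?ltr01// powR1 mulr1 le_eqVlt => /predU1P[<-|c0]; [by left|right].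
  split=> //; rewrite -subr_le0; apply: (cm_itv_growth cmf c0) => t t1.
  by rewrite fE'// (lt_le_trans ltr01).
- apply: (@cm_completely_monotone _ a _ (cst 0)) => [n|x xa].
    exact: cm_upto_cst.
  by rewrite fE// c0 mul0r.
- apply: (@cm_completely_monotone _ a _ (fun t => c * t `^ (alpha - 1))) => [n|x xa].
    apply: cm_uptoM; first by apply: cm_upto_cst; exact: ltW.
    by apply: cm_upto_powR; rewrite subr_le0.
  by rewrite fE.
Qed.

Lemma not_cm_lt0 (I : interval R) f x : x \in I -> f x < 0 ->
  ~ completely_monotone I f.
Proof.
by move=> xI fx /(_ 0%N x xI)[_]; rewrite expr0 mul1r leNgt fx.
Qed.

End completely_monotone_itv.

(** * Return to the variable x and proof of the three cases *)

Lemma f_abE (R : realType) (a b alpha beta x : R) :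
  f_ab a b alpha beta x = psi_ratio (@digamma R) (b - a) alpha beta (x + a).
Proof.
by rewrite /f_ab /psi_ratio (_ : x + b = x + a + (b - a)); last ring.
Qed.

Theorem theorem2p17 (R : realType) (a b alpha beta : R) (ha : 0 <= a) (hb : 0 <= b) :
  (* (i) *)
  (b = a ->
     (completely_monotone `]- a, +oo[ (f_ab a b alpha beta) <->
      (beta = 0 \/ (beta < 0 /\ alpha <= 1)))) /\
  (* (ii) *)
  (b = a + 1 ->
     (completely_monotone `]- a, +oo[ (f_ab a b alpha beta) <->
      (beta = 1 \/ (beta < 1 /\ alpha <= 1)))) /\
  (* (iii) *)
  (b <> a -> b <> a + 1 -> 0 < 1 - b + a < 1 -> beta <= b - a ->
     (* (iii_1) *)
     (alpha <= 1 ->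
        completely_monotone `]- a, +oo[ (f_ab a b alpha beta) /\
        (* the lower bound a for b is sharp *)
        (forall b' : R, 0 <= b' -> b' < a ->
           exists beta' : R, beta' <= b' - a /\
             ~ completely_monotone `](Num.max (- a) (- b')), +oo[
                 (f_ab a b' alpha beta')) /\
        (* the upper bound a + 1 for b is sharp *)
        (forall b' : R, 0 <= b' -> a + 1 < b' ->
           exists beta' : R, beta' <= b' - a /\
             ~ completely_monotone `](Num.max (- a) (- b')), +oo[
                 (f_ab a b' alpha beta')) /\
        (* the upper bound b - a for beta is sharp *)
        (forall beta' : R, b - a < beta' ->
           ~ completely_monotone `]- a, +oo[ (f_ab a b alpha beta'))) /\
     (* (iii_2) *)
     (completely_monotone `]- a, +oo[ (f_ab a b alpha beta) ->
        (beta < b - a -> alpha <= 1) /\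
        (beta = b - a -> alpha <= 2))).
Proof.
have nd := @digamma_nondecreasing R; have D1 := @digammaD1 R.
have sub_a t : t - a + a = t by rewrite subrK.
split; [|split].
- move=> ba; rewrite (@cm_itv_powRP _ a _ alpha (- beta)); last first.
    by move=> x xa; rewrite f_abE ba subrr psi_ratio0E.
  by split=> [[b0|[b0 al]]|[b0|[b0 al]]]; [left|right|left|right]; try split => //; lra.
- move=> ba; rewrite (@cm_itv_powRP _ a _ alpha (1 - beta)); last first.
    by move=> x xa; rewrite f_abE ba addrAC subrr add0r psi_ratio1E.
  by split=> [[b0|[b0 al]]|[b0|[b0 al]]]; [left|right|left|right]; try split => //; lra.
- move=> _ _ /andP[d1' d0'] bd.
  have [d0 d1] : 0 < b - a /\ b - a < 1 by split; lra.
  split=> [al|cmf].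
    split.
      apply: (cm_completely_monotone (cm_psi_ratio nd D1 d0 d1 bd al)) => x _.
      exact: f_abE.
    split=> [b' b'0 b'a|].
      (* The largest admissible beta' already fails, near the left endpoint -b' of the domain. *)
      exists (b' - a); split=> //.
      have ab' : 0 < a - b' by lra.
      have [t t0 ft] := psi_ratio_lt0_neg nd D1 alpha ab'.
      apply: (@not_cm_lt0 _ _ _ (t - a)); last by rewrite f_abE sub_a -(opprB a b').
      by rewrite in_itv/= andbT gt_max; apply/andP; split; lra.
    split=> [b' b'0 b'a|beta' bb'].
      (* Again the largest admissible beta', now failing near the left endpoint -a. *)
      exists (b' - a); split=> //.
      have ab' : 1 < b' - a by lra.
      have [t t0 ft] := psi_ratio_lt0_gt1 nd D1 alpha ab'.
      apply: (@not_cm_lt0 _ _ _ (t - a)); last by rewrite f_abE sub_a.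
      by rewrite in_itv/= andbT gt_max; apply/andP; split; lra.
    have [t t0 ft] := psi_ratio_lt0_beta nd D1 alpha d0 d1 bb'.
    apply: (@not_cm_lt0 _ _ _ (t - a)); last by rewrite f_abE sub_a.
    by rewrite in_itv/= andbT; lra.
  (* In both cases f has a lower bound c t^p with c > 0 on t >= 1, where p is alpha - 1 or alpha -
     2, and growth forces p <= 0. *)
  split=> [be|be]; rewrite -subr_le0.
    have c0 : 0 < b - a - beta by rewrite subr_gt0.
    apply: (cm_itv_growth cmf c0) => t t1; rewrite f_abE sub_a.
    by apply: (psi_ratio_ge nd D1 alpha beta d0 d1); lra.
  have c0 : 0 < (b - a) * (1 - (b - a)) / 4 by rewrite divr_gt0// mulr_gt0//; lra.
  apply: (cm_itv_growth cmf c0) => t t1; rewrite f_abE sub_a be.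
  exact: psi_ratio_ge_critical.
Qed.
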